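(* Let $R$ be a ring and let $e\in R$ be a nonzero idempotent. Then $R$ is both right $e$-reversible and prime if and only if $R$ is a domain.
   Context: All rings are associative with identity (not necessarily commutative). For a nonzero idempotent $e\in R$, the ring $R$ is right $e$-reversible if for all $a,b\in R$, $ab=0$ implies $bae=0$. A domain is a nonzero (not necessarily commutative) ring without nonzero zero divisors. *)

(* Defs.v *)
From mathcomp Require Import all_boot all_algebra.
Set Implicit Arguments. Unset Strict Implicit. Unset Printing Implicit Defensive.
Import GRing.Theory.
Local Open Scope ring_scope.

Definition right_e_reversible (R : pzRingType) (e : R) : Prop :=
  forall a b : R, a * b = 0 -> b * a * e = 0.

(* The ideals of ring_quotient are boolean predicates closed under left
   multiplication only; here ideals are two-sided and arbitrary. *)
Record two_sided_ideal (R : pzRingType) (I : R -> Prop) : Prop := {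
  ideal_0 : I 0;
  ideal_B : forall x y : R, I x -> I y -> I (x - y);
  ideal_Ml : forall r x : R, I x -> I (r * x);
  ideal_Mr : forall x r : R, I x -> I (x * r) }.

(* IJ consists of the finite sums of products xy with x in I and y in J. *)
Definition ideal_mul (R : pzRingType) (I J : R -> Prop) (z : R) : Prop :=
  exists2 s : seq (R * R),
    forall p, p \in s -> I p.1 /\ J p.2 & z = \sum_(p <- s) p.1 * p.2.

Definition ideal_is0 (R : pzRingType) (I : R -> Prop) : Prop :=
  forall x : R, I x -> x = 0.

Definition prime_ring (R : pzRingType) : Prop :=
  (1 : R) <> 0 /\
  forall I J : R -> Prop, two_sided_ideal I -> two_sided_ideal J ->
    ideal_is0 (ideal_mul I J) -> ideal_is0 I \/ ideal_is0 J.

Definition is_domain (R : pzRingType) : Prop :=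
  (1 : R) <> 0 /\ forall a b : R, a * b = 0 -> a = 0 \/ b = 0.

(* Main.v *)
Require Import Defs.
From mathcomp Require Import all_boot all_algebra.
From Stdlib Require Import Classical.
Import GRing.Theory.
Local Open Scope ring_scope.

(* If ab = 0 implies bae = 0, then e(1-e)r = 0 gives (1-e)Re = 0, so primeness
   forces e = 1. Hence ab = 0 implies ba = 0; applied to (ra)b = 0 this gives
   bRa = 0, so b = 0 or a = 0 by primeness. *)

(* Instead of the ideals RaR and RbR, use the larger ideals given by the left
   annihilator I of Rb and the right annihilator of I: no finite sums occur. *)
Lemma prime_ring_elt {R : pzRingType} {a b : R} :
  prime_ring R -> (forall r, a * r * b = 0) -> a = 0 \/ b = 0.
Proof.
case=> _ primeR arb0.
pose I (x : R) := forall r, x * r * b = 0.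
pose J (y : R) := forall x, I x -> x * y = 0.
have idealI : two_sided_ideal I.
  split=> [r | x y Ix Iy r | s x Ix r | x s Ix r].
  - by rewrite !mul0r.
  - by rewrite !mulrBl Ix Iy subr0.
  - by rewrite -!mulrA [x * _]mulrA Ix mulr0.
  - by rewrite -(mulrA x) Ix.
have idealJ : two_sided_ideal J.
  split=> [x _ | y z Jy Jz x Ix | s y Jy x Ix | y s Jy x Ix].
  - by rewrite mulr0.
  - by rewrite mulrBr Jy // Jz // subr0.
  (* Right annihilators absorb factors on the left because [I] is a right ideal. *)
  - by rewrite mulrA; apply: Jy; exact: (ideal_Mr idealI).
  - by rewrite mulrA Jy // mul0r.
have IJ0 : ideal_is0 (ideal_mul I J).
  move=> _ [s sIJ ->]; rewrite big_seq big1 // => p /sIJ[Ip Jp].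
  exact: Jp.
case: (primeR I J idealI idealJ IJ0) => [I0 | J0]; [left | right].
  exact: I0.
(* [b] lies in [J]: take [r = 1] in the definition of [I]. *)
by apply: J0 => x Ix; rewrite -[x]mulr1.
Qed.

Lemma prime_right_e_reversible_eq1 {R : pzRingType} {e : R} :
  e <> 0 -> e * e = e -> right_e_reversible e -> prime_ring R -> e = 1.
Proof.
move=> e_neq0 ee rev primeR.
have crossed0 r : (1 - e) * r * e = 0.
  (* Reversibility gives [(1 - e) * r * e * e = 0]; idempotence absorbs the extra [e]. *)
  rewrite -[RHS](rev e ((1 - e) * r)); first by rewrite -!mulrA ee.
  by rewrite mulrA mulrBr mulr1 ee subrr mul0r.
by case: (prime_ring_elt primeR crossed0) => // /subr0_eq.
Qed.

(** If [IJ = 0], a nonzero [y] in [J] would force every [x] in [I] to vanish. Excluded middle is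
    used since ideals are arbitrary predicates. *)
Lemma domain_prime (R : pzRingType) : is_domain R -> prime_ring R.
Proof.
case=> neq10 domR; split=> // I J _ _ IJ0.
have prod0 x y : I x -> J y -> x * y = 0.
  move=> Ix Jy; apply: IJ0; exists [:: (x, y)]; last by rewrite big_seq1.
  by move=> p; rewrite inE => /eqP->.
have [I0 | nI0] := classic (ideal_is0 I); [by left | right=> y Jy].
apply: NNPP => y_neq0; apply: nI0 => x Ix.
by case: (domR _ _ (prod0 _ _ Ix Jy)).
Qed.

Theorem proposition2p32 (R : pzRingType) (e : R)
    (e_neq0 : e <> 0) (e_idem : e * e = e) :
  (right_e_reversible e /\ prime_ring R) <-> is_domain R.
Proof.
split=> [[rev primeR] | domR].
  have e1 := prime_right_e_reversible_eq1 e_neq0 e_idem rev primeR.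
  split=> [|a b ab0]; first by case: primeR.
  have bra0 r : b * r * a = 0.
    (* The inserted factor [1] becomes the [e] of reversibility. *)
    by rewrite -[LHS]mulr1 -e1 -(mulrA b); apply: rev; rewrite -mulrA ab0 mulr0.
  by case: (prime_ring_elt primeR bra0); [right | left].
split; last exact: domain_prime.
by move=> a b /domR.2[] ->; rewrite ?(mulr0, mul0r).
Qed.
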